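(* Let $s\in[\tfrac14,\tfrac12]$, let $P\subset\mathbb{F}_q^d$ be a $(4,s)$-Salem set and let $H$ be a set of hyperplanes in $\mathbb{F}_q^d$ defined by $\mathbf{a}\cdot\mathbf{x}=b$ with $\mathbf{a}\ne\mathbf{0}$ and $b\ne0$. Then $$I(P,H)\le\frac{|P|\,|H|}{q}+|H|^{\frac34}q^{\frac{d-1}{4}}|P|^{1-s}.$$
   Context: $\mathbb{F}_q$ is a finite field with $q$ elements. $I(P,H)$ is the number of incidences, i.e. of pairs $(\mathbf{x},h)\in P\times H$ with $\mathbf{x}\in h$. Fix a nontrivial additive character $\chi$ of $\mathbb{F}_q$ and put $\widehat{P}(\mathbf{x})=q^{-d}\sum_{\mathbf{y}\in P}\chi(-\mathbf{x}\cdot\mathbf{y})$ and $\|\widehat{P}\|_4=\big(q^{-d}\sum_{\mathbf{x}\in\mathbb{F}_q^d\setminus\{\mathbf{0}\}}|\widehat{P}(\mathbf{x})|^4\big)^{1/4}$. The set $P$ is $(4,s)$-Salem if $\|\widehat{P}\|_4\ll q^{-d}|P|^{1-s}$, where $A\ll B$ means that there is an absolute constant $C>0$ such that $A\le CB$.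
   Formalization: The implied constant C in the (4,s)-Salem condition is made explicit and also multiplies the error term |H|^{3/4}q^{(d-1)/4}|P|^{1-s}; with C=1 this is the displayed bound, which fails as written for larger C (q=5, d=2, s=1/2, P a line missing the origin, H={P}). *)

(* Defs.v *)
From HB Require Import structures.
From mathcomp Require Import all_boot all_order all_algebra.
From mathcomp Require Import reals exp.
From mathcomp Require Import complex.

Set Implicit Arguments.
Unset Strict Implicit.
Unset Printing Implicit Defensive.

Import Order.TTheory GRing.Theory Num.Theory.
Import ComplexField.Normc.

Local Open Scope ring_scope.

Section Incidence.
Variables (F : finFieldType) (d : nat).

Definition dotp (x y : 'rV[F]_d) : F := \sum_i x 0 i * y 0 i.

Definition hyperplane (a : 'rV[F]_d) (b : F) : {set 'rV[F]_d} :=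
  [set x | dotp a x == b].

Definition incidences (P : {set 'rV[F]_d}) (H : {set {set 'rV[F]_d}}) : nat :=
  #|[set xh in setX P H | xh.1 \in xh.2]|.

End Incidence.

Section Salem.
Variables (R : realType) (F : finFieldType).

(* Taking value 1 at 0 excludes the zero map, so [chi] is a homomorphism from
   (F, +) to the multiplicative group of nonzero complex numbers. *)
Definition additive_character (chi : F -> R[i]) : Prop :=
  chi 0 = 1 /\ {morph chi : x y / x + y >-> x * y}.

Definition nontrivial_character (chi : F -> R[i]) : Prop :=
  additive_character chi /\ exists x, chi x <> 1.

Variable d : nat.

Definition fourier (chi : F -> R[i]) (P : {set 'rV[F]_d}) (x : 'rV[F]_d) :
    R[i] :=
  (#|F|%:R ^+ d)^-1 * \sum_(y in P) chi (- dotp x y).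

Definition fourier_norm4 (chi : F -> R[i]) (P : {set 'rV[F]_d}) : R :=
  ((#|F|%:R ^+ d)^-1 * \sum_(x : 'rV[F]_d | x != 0) normc (fourier chi P x) ^+ 4)
    `^ (1 / 4).

(* [C] is the constant implied in
   [fourier_norm4 chi P << #|F| ^ (- d) * #|P| ^ (1 - s)]. *)
Definition salem4 (chi : F -> R[i]) (C s : R) (P : {set 'rV[F]_d}) : Prop :=
  fourier_norm4 chi P <= C * ((#|F|%:R ^+ d)^-1 * #|P|%:R `^ (1 - s)).

End Salem.

(* Main.v *)
(** Scaling each equation to a.x = 1 identifies H with a set A of nonzero
    vectors.  With S(m) the unnormalised Fourier transform of P, the incidence
    count minus |P||H|/q is q^-1 times the sum of chi(t) S(t a) over t <> 0
    and a in A, i.e. of w(m) S(m) over m <> 0, where w(m) sums chi(t) over the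
    representations m = t a.  By orthogonality the sum of |w|^2 is at most
    q|A|, and the support of w has at most q|A| elements; two applications of
    Cauchy-Schwarz bound the fourth power of the sum by (q|A|)^3 times the sum
    of |S(m)|^4 over m <> 0, which the Salem condition controls. *)
Require Import Defs.
From mathcomp Require Import all_boot all_order all_algebra finfield.
From mathcomp Require Import reals exp.
From mathcomp Require Import complex.
From mathcomp Require Import ring.

Import Order.TTheory GRing.Theory Num.Theory.

Local Open Scope ring_scope.

(** * Cauchy-Schwarz and the dot product *)

(** Lagrange's identity: the double sum of (f_i g_j - f_j g_i)^2 is twice the difference of the two
    sides. Nonnegativity of [f] and [g] makes these terms real, so their squares are nonnegative
    even when [K] contains non-real numbers. *)
Lemma sum_mul_sqr_le (K : numFieldType) (I : finType) (D : pred I)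
    (f g : I -> K) :
  (forall i, 0 <= f i) -> (forall i, 0 <= g i) ->
  (\sum_(i | D i) f i * g i) ^+ 2
    <= (\sum_(i | D i) f i ^+ 2) * (\sum_(i | D i) g i ^+ 2).
Proof.
move=> f0 g0.
have h : 0 <= \sum_(i | D i) \sum_(j | D j) (f i * g j - f j * g i) ^+ 2.
  apply: sumr_ge0 => i _; apply: sumr_ge0 => j _.
  by rewrite -realEsqr rpredB // ger0_real ?mulr_ge0.
rewrite -subr_ge0 -(pmulr_rge0 _ (ltr0Sn K 1)).
suff <- : \sum_(i | D i) \sum_(j | D j) (f i * g j - f j * g i) ^+ 2
    = 2 * ((\sum_(i | D i) f i ^+ 2) * (\sum_(i | D i) g i ^+ 2)
           - (\sum_(i | D i) f i * g i) ^+ 2) by [].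
transitivity (\sum_(i | D i) (f i ^+ 2 * (\sum_(j | D j) g j ^+ 2)
   + g i ^+ 2 * (\sum_(j | D j) f j ^+ 2)
   - 2 * (f i * g i) * (\sum_(j | D j) f j * g j))).
  apply: eq_bigr => i _; rewrite !mulr_sumr -big_split -sumrB /=.
  by apply: eq_bigr => j _; ring.
by rewrite sumrB big_split /= -!mulr_suml -mulr_sumr; ring.
Qed.

Lemma dotpZl (F : finFieldType) (d : nat) (t : F) (a x : 'rV[F]_d) :
  dotp (t *: a) x = t * dotp a x.
Proof.
by rewrite /dotp mulr_sumr; apply: eq_bigr => i _; rewrite mxE mulrA.
Qed.

(** * Additive characters: values and orthogonality *)

Section Characters.
Variables (K : numClosedFieldType) (F : finFieldType) (chi : F -> K).
Hypotheses (chi0 : chi 0 = 1) (chiD : {morph chi : x y / x + y >-> x * y}).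

(** In characteristic p, chi(x)^p = chi(p x) = 1, so the norm is a nonnegative p-th root of 1. *)
Lemma character_norm x : `|chi x| = 1.
Proof.
have chiMn n : chi (x *+ n) = chi x ^+ n.
  by elim: n => [|n IH]; rewrite ?mulr0n ?chi0 // mulrS exprS chiD IH.
have [p p_pr pF] := finPcharP F.
apply/eqP; rewrite -(@pexpr_eq1 _ _ p) ?prime_gt0 //.
by rewrite -normrX -chiMn -mulr_natl (pcharf0 pF) mul0r chi0 normr1.
Qed.

Lemma character_conj x : (chi x)^* = chi (- x).
Proof.
have nz : chi x != 0 by rewrite -normr_eq0 character_norm oner_eq0.
apply: (mulfI nz); rewrite -chiD subrr chi0 -normCK character_norm.
by rewrite expr1n.
Qed.

Hypothesis chi_nt : exists x, chi x <> 1.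

(** For c <> 0 the sum is that of chi over F; translating by an x with chi(x) <> 1 multiplies it by
    chi(x), so it vanishes. *)
Lemma character_sum c : \sum_t chi (t * c) = (#|F| * (c == 0))%:R.
Proof.
have [->|nz] := eqVneq c 0.
  under eq_bigr do rewrite mulr0 chi0.
  by rewrite sumr_const muln1.
rewrite muln0 (reindex_inj (mulIf (invr_neq0 nz))) /=.
under eq_bigr do rewrite mulfVK //.
have [x nx] := chi_nt.
have e : chi x * \sum_t chi t = \sum_t chi t.
  rewrite mulr_sumr [RHS](reindex_inj (addrI x)) /=.
  by apply: eq_bigr => t _; rewrite chiD.
have /eqP : (chi x - 1) * \sum_t chi t = 0 by rewrite mulrBl e mul1r subrr.
by rewrite mulf_eq0 subr_eq0 => /orP[/eqP|/eqP].
Qed.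

(** * Weights on the multiples of the normal vectors *)

Section Weights.
Variables (d : nat) (A : {set 'rV[F]_d}).
Hypothesis A0 : 0 \notin A.

(** Several pairs (t, a) may give the same m, since [A] can contain several points of one line
    through the origin. *)
Definition ray_weight (m : 'rV[F]_d) : K :=
  \sum_(a in A) \sum_(t | (t != 0) && (t *: a == m)) chi t.

Lemma sum_ray_weight (S : 'rV[F]_d -> K) :
  \sum_(a in A) \sum_(t | t != 0) chi t * S (t *: a)
    = \sum_m ray_weight m * S m.
Proof.
transitivity (\sum_m \sum_(a in A)
    \sum_(t | (t != 0) && (t *: a == m)) chi t * S m); last first.
  apply: eq_bigr => m _; rewrite mulr_suml.
  by apply: eq_bigr => a _; rewrite mulr_suml.
rewrite [RHS]exchange_big /=; apply: eq_bigr => a _.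
rewrite [RHS](exchange_big_dep (fun t => t != 0)) /=; last first.
  by move=> m t _ /andP[].
apply: eq_bigr => t nt.
by rewrite (eq_bigl (pred1 (t *: a))) ?big_pred1_eq // => m; rewrite nt eq_sym.
Qed.

Lemma ray_weight_energy :
  \sum_m `|ray_weight m| ^+ 2 <= (#|F| * #|A|)%:R.
Proof.
under eq_bigr do rewrite normCK.
rewrite -sum_ray_weight.
have -> : \sum_(a in A) \sum_(t | t != 0) chi t * (ray_weight (t *: a))^*
  = \sum_(a in A) \sum_(a' in A) \sum_(c | (c != 0) && (c *: a' == a))
      \sum_(t | t != 0) chi (t * (1 - c)).
  apply: eq_bigr => a _.
  transitivity (\sum_(t | t != 0) \sum_(a' in A)
     \sum_(c | (c != 0) && (c *: a' == a)) chi (t * (1 - c))).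
    apply: eq_bigr => t nt; rewrite rmorph_sum mulr_sumr /=.
    apply: eq_bigr => a' _; rewrite rmorph_sum mulr_sumr /=.
    (* Writing the second scalar as t c turns (t c) a' = t a into c a' = a, a condition free of
       t. *)
    rewrite (reindex_inj (mulfI nt)) /=; apply: eq_big => [c|c _].
      rewrite mulf_eq0 negb_or nt /= -scalerA; congr (_ && _).
      by apply/eqP/eqP => [/(scalerI nt)|->].
    by rewrite character_conj -chiD mulrBr mulr1.
  rewrite exchange_big /=; apply: eq_bigr => a' _.
  by rewrite exchange_big.
apply: (@le_trans _ _ (\sum_(a in A) \sum_(a' in A) (#|F| * (a' == a))%:R)).
  apply: ler_sum => a _; apply: ler_sum => a' a'A.
  apply: (@le_trans _ _ (\sum_(c | (c != 0) && (c *: a' == a))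
                            (#|F| * (c == 1))%:R)).
    apply: ler_sum => c _.
    (* Restoring the term t = 0, which equals 1, completes the orthogonality sum; the sum over t <>
       0 is thus q - 1 if c = 1 and -1 otherwise. *)
    have := character_sum (1 - c); rewrite (bigD1 0) //= mul0r chi0 subr_eq0.
    by rewrite [1 == c]eq_sym => <-; rewrite lerDr ler01.
  rewrite (eq_bigr (fun c => if c == 1 then #|F|%:R else 0)); last first.
    by move=> c _; case: (c == 1); rewrite ?muln1 ?muln0.
  rewrite -big_mkcondr /=.
  (* Only c = 1 survives, and it forces a' = a. *)
  have [<-|ne] := eqVneq a' a.
    rewrite (eq_bigl (pred1 1)) ?big_pred1_eq ?muln1 // => c /=.
    have [->|_] := eqVneq c 1; last by rewrite andbF.
    by rewrite oner_eq0 scale1r eqxx.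
  rewrite big1 ?muln0 // => c /andP[/andP[_ /eqP e] /eqP c1].
  by rewrite -e c1 scale1r eqxx in ne.
rewrite mulnC natrM mulr_natl -sumr_const; apply: ler_sum => a aA.
rewrite (bigD1 a) //= eqxx muln1 big1 ?addr0 // => a' /andP[_ /negPf ->].
by rewrite muln0.
Qed.

Lemma ray_weight_support :
  (#|[set m | ray_weight m != 0%R]| <= #|F| * #|A|)%N.
Proof.
rewrite -cardsT -cardsX.
apply: leq_trans (leq_imset_card (fun ta => ta.1 *: ta.2) _).
apply/subset_leq_card/subsetP => m; rewrite inE; apply: contraNT => mN.
rewrite /ray_weight big1 // => a aA; rewrite big1 // => t /andP[_ /eqP e].
by case/imsetP: mN; exists (t, a); rewrite // inE in_setT.
Qed.

(** The Salem norm omits the frequency 0, so that frequency must carry no weight. *)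
Lemma ray_weight0 : ray_weight 0 = 0.
Proof.
rewrite /ray_weight big1 // => a aA; rewrite big1 // => t.
rewrite scaler_eq0 => /andP[/negPf -> /= /eqP a0].
by rewrite a0 (negPf A0) in aA.
Qed.

Lemma ray_sum_norm4 (S : 'rV[F]_d -> K) :
  `|\sum_(a in A) \sum_(t | t != 0) chi t * S (t *: a)| ^+ 4
    <= (#|F| * #|A|)%:R ^+ 3 * \sum_(m | m != 0) `|S m| ^+ 4.
Proof.
set N : K := (_ * _)%:R; have N0 : 0 <= N by apply: ler0n.
pose D := [set m | ray_weight m != 0].
rewrite sum_ray_weight.
have -> : \sum_m ray_weight m * S m = \sum_(m in D) ray_weight m * S m.
  rewrite [RHS]big_mkcond; apply: eq_bigr => m _; rewrite inE.
  by case: eqP => // ->; rewrite mul0r.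
have SX : \sum_(m in D) `|S m| ^+ 4 <= \sum_(m | m != 0) `|S m| ^+ 4.
  rewrite big_mkcond [leRHS]big_mkcond; apply: ler_sum => m _; rewrite inE.
  have [->|_] := eqVneq m 0; first by rewrite ray_weight0 eqxx.
  by case: ifP => _ //; rewrite exprn_ge0.
(* Cauchy-Schwarz against the constant 1 on the support [D], which has at most [N] elements. *)
have S2 : (\sum_(m in D) `|S m| ^+ 2) ^+ 2
    <= N * \sum_(m | m != 0) `|S m| ^+ 4.
  have := @sum_mul_sqr_le _ _ (mem D) (fun=> 1) (fun m => `|S m| ^+ 2)
            (fun=> ler01) (fun m => exprn_ge0 2 (normr_ge0 (S m))).
  under eq_bigr do rewrite mul1r.
  under [X in _ <= X * _]eq_bigr do rewrite expr1n.
  under [X in _ <= _ * X]eq_bigr do rewrite -exprM.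
  move=> /le_trans; apply.
  rewrite sumr_const; apply: ler_pM => //.
  - by apply: sumr_ge0 => m _; rewrite exprn_ge0.
  - by rewrite ler_nat; exact: ray_weight_support.
have w2 : \sum_(m in D) `|ray_weight m| ^+ 2 <= N.
  apply: le_trans ray_weight_energy.
  rewrite big_mkcond; apply: ler_sum => m _.
  by case: ifP => _ //; rewrite exprn_ge0.
(* Cauchy-Schwarz against the weights, whose energy is at most [N]; passing to norms first supplies
   nonnegative factors. *)
have CS : `|\sum_(m in D) ray_weight m * S m| ^+ 2
    <= N * \sum_(m in D) `|S m| ^+ 2.
  apply: (@le_trans _ _ ((\sum_(m in D) `|ray_weight m| * `|S m|) ^+ 2)).
    rewrite lerXn2r ?nnegrE ?sumr_ge0 // => [m _|]; first by rewrite mulr_ge0.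
    by under [leRHS]eq_bigr do rewrite -normrM; apply: ler_norm_sum.
  apply: le_trans (sum_mul_sqr_le _ _ _ _ _ _ _) _ => //.
  by rewrite ler_wpM2r // sumr_ge0 // => m _; rewrite exprn_ge0.
rewrite (exprM _ 2 2).
apply: (@le_trans _ _ ((N * \sum_(m in D) `|S m| ^+ 2) ^+ 2)).
  rewrite lerXn2r ?nnegrE ?exprn_ge0 ?mulr_ge0 //.
  by apply: sumr_ge0 => m _; rewrite exprn_ge0.
by rewrite exprMn [N ^+ 3]exprSr -[leRHS]mulrA ler_wpM2l ?exprn_ge0.
Qed.

End Weights.

(** The sum of chi(t (1 - a.x)) over all t is q when x lies on the hyperplane and 0 otherwise; t = 0
    yields the main term. *)
Lemma sum_card_hyperplane (d : nat) (P A : {set 'rV[F]_d}) :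
  #|F|%:R * (\sum_(a in A) #|P :&: hyperplane a 1%R|)%:R
    = (#|P| * #|A|)%:R
      + \sum_(a in A) \sum_(t | t != 0)
          chi t * \sum_(x in P) chi (- dotp (t *: a) x).
Proof.
rewrite mulnC natrM [X in _ = X + _]mulr_natl -[_ *+ #|A|]sumr_const.
rewrite -big_split natr_sum mulr_sumr /=.
apply: eq_bigr => a _.
transitivity (\sum_t \sum_(x in P) chi (t * (1 - dotp a x))).
  rewrite exchange_big /= -[#|_ :&: _|]sum1_card natr_sum mulr_sumr.
  rewrite [LHS]big_mkcond [RHS]big_mkcond /=; apply: eq_bigr => x _.
  rewrite !inE; case: (x \in P) => //=.
  rewrite character_sum subr_eq0 eq_sym.
  by case: eqP; rewrite ?muln1 ?muln0 ?mulr1.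
rewrite (bigD1 0) //=; congr (_ + _).
  by under eq_bigr do rewrite mul0r chi0; rewrite sumr_const.
apply: eq_bigr => t _; rewrite mulr_sumr; apply: eq_bigr => x _.
by rewrite -chiD dotpZl mulrBr mulr1.
Qed.

End Characters.

(** * Normal vectors of hyperplanes avoiding the origin *)

Lemma hyperplane_scale (F : finFieldType) (d : nat) (a : 'rV[F]_d) (b : F) :
  b != 0 -> hyperplane a b = hyperplane (b^-1 *: a) 1.
Proof.
move=> b0; apply/setP => x; rewrite !inE dotpZl.
by rewrite -(inj_eq (mulfI (invr_neq0 b0))) mulVf.
Qed.

Lemma hyperplane_normals (F : finFieldType) (d : nat)
    (H : {set {set 'rV[F]_d}}) :
  (forall h, h \in H ->
     exists (a : 'rV[F]_d) (b : F), [/\ a != 0, b != 0 & h = hyperplane a b]) ->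
  exists A : {set 'rV[F]_d}, [/\ 0 \notin A, #|A| = #|H|
    & forall P, incidences P H = (\sum_(a in A) #|P :&: hyperplane a 1%R|)%N].
Proof.
move=> hH.
(* A choice of normal for each h; the default 0 is never taken on [H]. As h is recovered from [g h],
   the map is injective there. *)
pose g (h : {set 'rV[F]_d}) :=
  odflt 0 [pick a | (a != 0) && (h == hyperplane a 1)].
have gP h : h \in H -> g h != 0 /\ h = hyperplane (g h) 1.
  move=> /hH [a [b [a0 b0 e]]]; rewrite /g.
  case: pickP => [a' /andP[? /eqP] //|].
  move=> /(_ (b^-1 *: a)); rewrite scaler_eq0 invr_eq0 (negPf a0) (negPf b0).
  by rewrite e -hyperplane_scale ?eqxx.
have g_inj : {in H &, injective g}.
  by move=> h k /gP[_ {2}->] /gP[_ {2}->] ->.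
exists (g @: H); split; first by apply/imsetP => -[h /gP[/eqP nz _] /esym].
  by rewrite card_in_imset.
move=> P; rewrite big_imset //= /incidences -sum1_card.
rewrite (eq_bigr (fun h : {set 'rV[F]_d} => \sum_(x in P | x \in h) 1)%N).
  rewrite (exchange_big_dep (mem P)) => [|h x _ /andP[] //].
  rewrite pair_big_dep /=; apply: eq_bigl => -[x h].
  by rewrite !inE /= -andbA; case: (x \in P).
by move=> h /gP[_ <-]; rewrite -sum1_card; apply: eq_bigl => x; rewrite inE.
Qed.

(** * Exponents and conclusion *)

(** The Salem bound gives X <= q^d (C q^-d p)^4; inserting it leaves E^4 <= C^4 n^3 q^(d-1) p^4,
    whose fourth root is the claim. *)
Lemma le_of_fourth_powers (R : realType) (d : nat) (C q n p X E : R) :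
  0 < C -> 0 < q -> 0 <= n -> 0 <= p -> 0 <= X ->
  (q * E) ^+ 4 <= (q * n) ^+ 3 * ((q ^+ d) ^+ 4 * X) ->
  ((q ^+ d)^-1 * X) `^ (1 / 4) <= C * ((q ^+ d)^-1 * p) ->
  E <= C * (n `^ (3 / 4) * q `^ ((d%:R - 1) / 4) * p).
Proof.
move=> hC q0 n0 p0 X0 qE4 hP.
have qd0 : 0 < q ^+ d by rewrite exprn_gt0.
have powR4 (x y : R) : (x `^ (y / 4)) ^+ 4 = x `^ y.
  by rewrite -powR_mulrn ?powR_ge0 // -powRrM divfK ?pnatr_eq0.
have XE : X <= q ^+ d * (C * ((q ^+ d)^-1 * p)) ^+ 4.
  rewrite -ler_pdivrMl //.
  have -> : (q ^+ d)^-1 * X = (((q ^+ d)^-1 * X) `^ (1 / 4)) ^+ 4.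
    by rewrite powR4 powRr1 // mulr_ge0 // invr_ge0 ltW.
  by rewrite lerXn2r // nnegrE ?powR_ge0 // !mulr_ge0 // ?invr_ge0 ltW.
set T := C * _.
have T0 : 0 <= T by rewrite !mulr_ge0 ?powR_ge0 // ltW.
have T4 : T ^+ 4 = C ^+ 4 * (n ^+ 3 * (q ^+ d / q) * p ^+ 4).
  have qB : q `^ (d%:R - 1) = q ^+ d / q.
    by rewrite powRB ?(gt_eqF q0) ?implybT // powRr1 ?powR_mulrn // ltW.
  rewrite /T (exprMn _ C) (exprMn _ _ p) (exprMn _ (n `^ _)) !powR4 qB.
  by rewrite (powR_mulrn 3 n0).
have : E ^+ 4 <= T ^+ 4.
  rewrite T4 -(ler_pM2l (exprn_gt0 4 q0)) -exprMn; apply: (le_trans qE4).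
  apply: (@le_trans _ _ ((q * n) ^+ 3 * ((q ^+ d) ^+ 4 *
     (q ^+ d * (C * ((q ^+ d)^-1 * p)) ^+ 4)))).
    rewrite ler_wpM2l ?exprn_ge0 ?mulr_ge0 ?(ltW q0) //.
    by rewrite ler_wpM2l // exprn_ge0 // ltW.
  rewrite le_eqVlt; apply/orP; left; apply/eqP.
  by field; rewrite !gt_eqF.
(* Fourth roots may be taken when E >= 0; a negative E is below T >= 0 anyway. *)
have [E0|/ltW E0 _] := leP 0 E; last exact: le_trans E0 T0.
by rewrite ler_pXn2r.
Qed.

Theorem theorem41 (R : realType) (C : R) (hC : 0 < C)
    (F : finFieldType) (d : nat)
    (chi : F -> R[i]) (hchi : nontrivial_character chi)
    (s : R) (hs : 1 / 4 <= s <= 1 / 2)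
    (P : {set 'rV[F]_d}) (hP : salem4 chi C s P)
    (H : {set {set 'rV[F]_d}})
    (hH : forall h, h \in H ->
       exists (a : 'rV[F]_d) (b : F), [/\ a != 0, b != 0 & h = hyperplane a b]) :
  (incidences P H)%:R <=
    #|P|%:R * #|H|%:R / #|F|%:R
    + C * (#|H|%:R `^ (3 / 4) * #|F|%:R `^ ((d%:R - 1) / 4)
           * #|P|%:R `^ (1 - s)).
Proof.
case: hchi => -[chi0 chiD] chi_nt.
have [A [A0 <- ->]] := hyperplane_normals _ _ _ hH.
set I := (\sum_(a in A) _)%N.
move: hP; rewrite /salem4 /fourier_norm4.
set q : R := #|F|%:R; set n : R := #|A|%:R; set p := #|P|%:R `^ (1 - s).
set X := \sum_(x | _) _ => hP.
have q0 : 0 < q by rewrite ltr0n; apply/card_gt0P; exists 0.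
have n0 : 0 <= n by rewrite ler0n.
have p0 : 0 <= p by rewrite powR_ge0.
have X0 : 0 <= X.
  by apply: sumr_ge0 => x _; rewrite exprn_ge0 // -ler0c;
    apply: (normr_ge0 (_ : R[i])).
pose E := I%:R - #|P|%:R * n / q.
have qE4 : (q * E) ^+ 4 <= (q * n) ^+ 3 * ((q ^+ d) ^+ 4 * X).
  have qE : (q * E)%:C%C = \sum_(a in A) \sum_(t | t != 0)
      chi t * \sum_(x in P) chi (- dotp (t *: a) x).
    apply: (addrI (#|P| * #|A|)%:R).
    rewrite -(sum_card_hyperplane _ _ _ chi0 chiD chi_nt) -/I.
    rewrite /E -!(rmorph_nat (real_complex R)) -(rmorphM (real_complex R)).
    rewrite -(rmorphD (real_complex R)); congr (real_complex R _).
    by rewrite natrM -/q -/n; field; rewrite gt_eqF.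
  (* The comparison moves to [R[i]], where the character sums live; q E is real, so its fourth power
     is that of its norm. *)
  rewrite -lecR; apply: le_trans (_ : `|(q * E)%:C%C| ^+ 4 <= _).
    rewrite rmorphXn /= -normrX ger0_norm // -rmorphXn /= ler0c.
    by rewrite (exprM _ 2 2) sqr_ge0.
  rewrite qE; apply: le_trans (ray_sum_norm4 _ _ _ chi0 chiD chi_nt _ _ A0
    (fun m => \sum_(x in P) chi (- dotp m x))) _.
  rewrite (rmorphM (real_complex R)) (rmorphXn (real_complex R)) /X.
  rewrite [_ ^+ 4 * _]mulr_sumr.
  rewrite (rmorph_sum (real_complex R)).
  rewrite /q /n -natrM (rmorph_nat (real_complex R)).
  rewrite le_eqVlt; apply/orP; left; apply/eqP.
  congr (_ * _); apply: eq_bigr => x _.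
  rewrite -exprMn (rmorphXn (real_complex R)); congr (_ ^+ 4).
  rewrite (rmorphM (real_complex R)) (rmorphXn (real_complex R)) /=.
  rewrite (rmorph_nat (real_complex R)).
  (* The norm of [R[i]] is the embedded [normc]; the factor q^-d in [fourier] cancels against
     q^d. *)
  rewrite -[(ComplexField.Normc.normc _)%:C%C]/`|fourier chi P x| /fourier.
  rewrite normrM ger0_norm ?invr_ge0 ?exprn_ge0 //.
  by rewrite mulVKf // expf_neq0 // pnatr_eq0 -lt0n -(ltr0n R).
by rewrite -lerBlDl; apply: le_of_fourth_powers hP.
Qed.
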